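(* Let $n\ge 1$, let $X_1,\ldots,X_n$ be independent random variables, each uniform on $\{-1,1\}$, and let $Y_i=0$ for $i=1,\ldots,n$. Let $$f(x_1,\ldots,x_n)=x_1(|x_1|+\cdots+|x_n|),$$ and for $i=0,\ldots,n$ let $Z_i=f(X_1,\ldots,X_i,Y_{i+1},\ldots,Y_n)$. Then $Z_i=iX_1$ and $EZ_i=0$ for all $i=0,\ldots,n$, and $$(Z_0-Z_n)^2=n^2,\qquad \sum_{i=1}^n (Z_i-Z_{i-1})^2=n .$$ Consequently, even if $X_i,Y_i$ are required to take values in a three-element set and $EZ_i=0$ for all $i$, but $X_i$ and $Y_i$ are allowed to have different laws (with the pairs $(X_i,Y_i)$ independent as $i$ varies), the factor $n$ in the bound $E(Z_n-Z_0)^2\le n\sum_{i=1}^n E(Z_i-Z_{i-1})^2$ cannot be improved.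
   Context: By definition $Z_0=f(Y_1,\ldots,Y_n)$ and $Z_n=f(X_1,\ldots,X_n)$. The bound $E(Z_n-Z_0)^2\le n\sum_{i=1}^nE(Z_i-Z_{i-1})^2$ holds for arbitrary random variables $Z_0,\ldots,Z_n$ by the Cauchy-Schwarz inequality; that the factor $n$ cannot be improved means that it cannot be replaced by any smaller constant depending only on $n$. *)

(* Defs.v *)
From HB Require Import structures.
From mathcomp Require Import all_boot all_order all_algebra.
From mathcomp Require Import all_classical all_reals all_analysis.

Set Implicit Arguments.
Unset Strict Implicit.
Unset Printing Implicit Defensive.

Import Order.TTheory GRing.Theory Num.Theory.
Import numFieldNormedType.Exports.

Local Open Scope classical_set_scope.
Local Open Scope ring_scope.

(* Mutual independence of finitely many random elements: the product rule over
   every subfamily J. *)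
Definition mutually_independent (d d' : measure_display) (T : measurableType d)
    (T' : measurableType d') (R : realType) (P : probability T R) (n : nat)
    (X : 'I_n -> T -> T') : Prop :=
  forall (J : {set 'I_n}) (A : 'I_n -> set T'),
    (forall i, i \in J -> measurable (A i)) ->
    P (\bigcap_(i in [set` J]) (X i @^-1` A i)) =
    (\prod_(i in J) P (X i @^-1` A i))%E.

(* Only the law is prescribed, so X may leave {-1, 1} on a null set. *)
Definition uniform_pm1 (d : measure_display) (T : measurableType d)
    (R : realType) (P : probability T R) (X : T -> R) : Prop :=
  P (X @^-1` [set 1]) = (2^-1)%:E /\ P (X @^-1` [set -1]) = (2^-1)%:E.

(* Z_i = f(X_1, ..., X_i, Y_{i+1}, ..., Y_n). Coordinates are numbered from 0,
   so the ones taken from X are those j with j < i. *)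
Definition hybrid (T : Type) (R : realType) (n : nat) (f : ('I_n -> R) -> R)
    (X Y : 'I_n -> T -> R) (i : nat) : T -> R :=
  fun w => f (fun j : 'I_n => if (j < i)%N then X j w else Y j w).

(* f(x_1, ..., x_n) = x_1 (|x_1| + ... + |x_n|); the proof of 0 < n provides the
   index of x_1. *)
Definition f_ex (R : realType) (n : nat) (hn : (0 < n)%N) (x : 'I_n -> R) : R :=
  x (Ordinal hn) * \sum_(j < n) `|x j|.

(* c is an admissible constant in E(Z_n - Z_0)^2 <= c sum_i E(Z_i - Z_{i-1})^2,
   for S-valued X_i, Y_i with independent pairs (X_i, Y_i) and with E Z_i = 0.
   Within a pair, X_i and Y_i may be dependent and have different laws. For
   finite S the Z_i are simple functions, whence no condition on f. *)
Definition admissible_constant (R : realType) (n : nat) (S : set R) (c : R) :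
    Prop :=
  forall (d : measure_display) (T : measurableType d) (P : probability T R)
    (X Y : 'I_n -> {RV P >-> R}) (f : ('I_n -> R) -> R),
    (forall i w, S (X i w) /\ S (Y i w)) ->
    mutually_independent P (fun i w => (X i w, Y i w)) ->
    (forall i : nat, (i <= n)%N -> ('E_P[hybrid f X Y i] = 0)%E) ->
    ('E_P[fun w => ((hybrid f X Y n w - hybrid f X Y 0 w) ^+ 2)%R] <=
     c%:E * \sum_(i < n)
       'E_P[fun w => ((hybrid f X Y i.+1 w - hybrid f X Y i w) ^+ 2)%R])%E.

(* Main.v *)
Require Import Defs.
From HB Require Import structures.
From mathcomp Require Import all_boot all_order all_algebra.
From mathcomp Require Import all_classical all_reals all_analysis.
From mathcomp Require Import measurable_realfun.

Set Implicit Arguments.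
Unset Strict Implicit.
Unset Printing Implicit Defensive.

Import Order.TTheory GRing.Theory Num.Theory.
Import numFieldNormedType.Exports.

Local Open Scope classical_set_scope.
Local Open Scope ring_scope.

(** When the variables X_j take values in {-1, 1} and Y = 0, the sum
    |x_1| + ... + |x_n| counts the coordinates already taken from X, so that
    Z_i = i X_1 ([hybrid_f_exE]). Each increment Z_i - Z_(i-1) is then the same
    sign X_1: its square is 1, while the increments add up to n X_1 instead of
    cancelling, which is the equality case of the Cauchy-Schwarz inequality.
    Under [uniform_pm1] all this holds off a null set ([uniform_pm1_norm]), and
    E Z_i = i E X_1 = 0 ([expectation_uniform_pm1]).

    For a constant c admissible for a set S containing three distinct points
    a, b, o, the example is transported to S by relabelling: with phi sending
    a, b, o to 1, -1, 0, the function f_ex o phi, the variable X_1 uniform on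
    {a, b} and Y = o give the Z_i above. As f_ex depends on x_2, ..., x_n only
    through their absolute values, X_2, ..., X_n can be taken equal to the
    constant a, so that one fair coin is enough and independence is immediate
    ([mutually_independent_const]). The admissible inequality then reads
    n^2 <= c n, whence n <= c ([n_le_admissible_constant]). *)

(** At an outcome where all |X_j| are 1, the second factor of f_ex counts the
    indices j < i. The first factor is X_1 as soon as i > 0; for i = 0 it is 0,
    but so is the right-hand side. *)
Lemma hybrid_f_exE (T : Type) (R : realType) (n : nat) (hn : (0 < n)%N)
    (X : 'I_n -> T -> R) (w : T) (i : nat) :
    (forall j, `|X j w| = 1) -> (i <= n)%N ->
  hybrid (f_ex hn) X (fun _ _ => 0) i w = i%:R * X (Ordinal hn) w.
Proof.
move=> X1 ilen; rewrite /hybrid /f_ex /=.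
have -> : \sum_(j < n) `|if (j < i)%N then X j w else 0| = i%:R :> R.
  rewrite (eq_bigr (fun j : 'I_n => if (j < i)%N then 1 else 0)); last first.
    by move=> j _; case: ifP; rewrite ?normr0 ?X1.
  rewrite -big_mkcond /= -(big_ord_widen n (fun=> 1) ilen).
  by rewrite sumr_const card_ord.
by case: i ilen => [|i] _; rewrite ?mul0r ?mulr0//= mulrC.
Qed.

Lemma hybrid_comp (T : Type) (R : realType) (n : nat) (f : ('I_n -> R) -> R)
    (phi : R -> R) (X Y : 'I_n -> T -> R) (i : nat) :
  hybrid (fun x => f (phi \o x)) X Y i =
  hybrid f (fun j => phi \o X j) (fun j => phi \o Y j) i.
Proof.
apply/funext => w; congr f; apply/funext => j /=.
by rewrite [LHS]fun_if.
Qed.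

Lemma uniform_pm1_norm (d : measure_display) (T : measurableType d)
    (R : realType) (P : probability T R) (X : {RV P >-> R}) :
  uniform_pm1 P X -> {ae P, forall w, `|X w| = 1}.
Proof.
move=> [X1 XN1].
have m1 : measurable (X @^-1` [set 1]) by exact: measurable_funPTI.
have mN1 : measurable (X @^-1` [set -1]) by exact: measurable_funPTI.
exists (~` (X @^-1` [set 1] `|` X @^-1` [set -1])); split.
- by apply: measurableC; exact: measurableU.
- rewrite probability_setC; last exact: measurableU.
  rewrite measureU//.
    rewrite [X in (_ - X)%E](_ : _ = 1%E) ?subee//.
    rewrite [LHS](congr2 +%E X1 XN1) -EFinD; congr EFin.
    by rewrite [RHS]splitr mul1r.
  apply/seteqP; split => // w [/= -> /eqP].
  by rewrite gt_eqF// gtrN.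
- move=> w /= Xw [] E; apply: Xw; rewrite E ?normrN ?normr1//.
Qed.

(** The variable X agrees almost surely with the difference of the indicators
    of {X = 1} and {X = -1}, two events of the same probability. *)
Lemma expectation_uniform_pm1 (d : measure_display) (T : measurableType d)
    (R : realType) (P : probability T R) (X : {RV P >-> R}) (g : T -> R)
    (k : R) :
    uniform_pm1 P X -> measurable_fun setT g ->
    {ae P, forall w, g w = k * X w} ->
  'E_P[g]%E = 0%E.
Proof.
move=> uX mg gX; have [X1 XN1] := uX.
set A := X @^-1` [set 1]; set B := X @^-1` [set -1].
have mA : measurable A by exact: measurable_funPTI.
have mB : measurable B by exact: measurable_funPTI.
have LA : \1_A \in Lfun P 1.
  by apply/Lfun1_integrable; exact: integrable_indic.
have LB : \1_B \in Lfun P 1.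
  by apply/Lfun1_integrable; exact: integrable_indic.
transitivity 'E_P[k \o* (\1_A \- \1_B)%R]%E; last first.
  rewrite expectationZl ?rpredB// expectationB// !expectation_indic//.
  by rewrite X1 XN1 subee ?mule0.
rewrite unlock; apply: ae_eq_integral => //.
- exact/measurable_EFinP.
- apply/measurable_EFinP; apply: measurable_funM => //.
  by apply: measurable_funB; exact: measurable_indic.
- have := uniform_pm1_norm uX; apply: filterS2 gX => w /= -> /eqP Xw _.
  have N1 : (-1 == 1 :> R) = false by rewrite lt_eqF// gtrN.
  congr EFin; rewrite [RHS]mulrC; congr (_ * _).
  rewrite !indicE /A /B /=.
  rewrite eqr_norml ler01 andbT in Xw.
  case/orP: Xw => /eqP Xw.
    by rewrite mem_set// memNset ?subr0//= Xw => /esym/eqP; rewrite N1.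
  by rewrite memNset ?mem_set ?sub0r//= Xw => /eqP; rewrite N1.
Qed.

(** The event {X_i in A_i} is empty or full when X_i is constant. If one of
    those is empty, both sides of the product rule vanish; otherwise both
    reduce to the probability of the event at i0, or to 1 if i0 is not in J. *)
Lemma mutually_independent_const (d d' : measure_display)
    (T : measurableType d) (T' : measurableType d') (R : realType)
    (P : probability T R) (n : nat) (X : 'I_n -> T -> T') (i0 : 'I_n)
    (c : 'I_n -> T') :
    (forall i, i != i0 -> X i = cst (c i)) ->
  mutually_independent P X.
Proof.
move=> Xc J A _.
have [[i [iJ ii0 ciA]]|noi] :=
  pselect (exists i, [/\ i \in J, i != i0 & ~ A i (c i)]).
  have Xi0 : X i @^-1` A i = set0 by apply/seteqP; split=> // w; rewrite /= Xc.
  rewrite (bigD1 i)//= Xi0 measure0 mul0e.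
  rewrite (_ : \bigcap_(_ in _) _ = set0) ?measure0//.
  by apply/seteqP; split => // w /(_ i iJ); rewrite Xi0.
have XT i : i \in J -> i != i0 -> X i @^-1` A i = setT.
  move=> iJ ii0; apply/seteqP; split => // w _; rewrite /= Xc//.
  by apply: contrapT => ciA; apply: noi; exists i.
have [i0J|i0J] := boolP (i0 \in J).
  rewrite (bigD1 i0)//= big1 ?mule1; last first.
    by move=> i /andP[iJ ii0]; rewrite XT// probability_setT.
  congr (P _); apply/seteqP; split => [w /(_ i0 i0J)//|w Aw i /= iJ].
  have [->//|ii0] := eqVneq i i0.
  by have /seteqP[_ /(_ w)] := XT i iJ ii0; exact.
have JT i : i \in J -> X i @^-1` A i = setT.
  by move=> iJ; apply: XT => //; apply: contraNneq i0J => <-.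
rewrite big1 => [|i iJ]; last by rewrite JT// probability_setT.
rewrite (_ : \bigcap_(_ in _) _ = setT) ?probability_setT//.
apply/seteqP; split => // w _ i /= iJ.
by have /seteqP[_ /(_ w)] := JT i iJ; exact.
Qed.

(** Bundling: every subset of bool is measurable. *)
Lemma bool_rv (R : realType) (P : probability bool R) (g : bool -> R) :
  {X : {RV P >-> R} | X = g :> (bool -> R)}.
Proof.
have mg : measurable_fun setT g by [].
by exists (HB.pack_for {RV P >-> R} g (isMeasurableFun.Build _ _ _ _ g mg)).
Qed.

(** The extremal example, carried by a single fair coin: X_1 is a or b, and
    the relabelling phi turns the points a, b, o into 1, -1, 0. *)
Lemma n_le_admissible_constant (R : realType) (n : nat) (hn : (0 < n)%N)
    (S : set R) (a b o c : R) :
    a != b -> o != a -> o != b -> S a -> S b -> S o ->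
  admissible_constant n S c -> n%:R <= c.
Proof.
move=> ab oa ob Sa Sb So.
pose P : probability bool R := bernoulli_prob 2^-1.
pose phi x : R := (x == a)%:R - (x == b)%:R.
have phia : phi a = 1 by rewrite /phi eqxx (negbTE ab) subr0.
have phib : phi b = -1 by rewrite /phi eqxx eq_sym (negbTE ab) sub0r.
have phio : phi o = 0 by rewrite /phi (negbTE oa) (negbTE ob) subr0.
pose coin (t : bool) : R := if t then a else b.
pose i0 := Ordinal hn.
pose Xf (i : 'I_n) : bool -> R := if i == i0 then coin else cst a.
pose X i : {RV P >-> R} := sval (bool_rv P (Xf i)).
pose Y (i : 'I_n) : {RV P >-> R} := sval (bool_rv P (cst o)).
have XE i : X i = Xf i :> (_ -> _) by rewrite /X; case: bool_rv.
have YE i : Y i = cst o :> (_ -> _) by rewrite /Y; case: bool_rv.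
pose sgn : bool -> R := phi \o coin.
have [eps epsE] := bool_rv P sgn.
have ZE i : (i <= n)%N ->
    hybrid (fun x => f_ex hn (phi \o x)) X Y i = fun t => i%:R * sgn t.
  move=> ilen; rewrite hybrid_comp; apply/funext => t.
  have -> : (fun j => phi \o Y j) = (fun _ _ => 0).
    by apply/funext => j; apply/funext => u; rewrite /= YE /= phio.
  rewrite hybrid_f_exE// => [|j]; first by rewrite /= XE /Xf eqxx.
  rewrite /= XE /Xf; case: ifP => _; rewrite /= ?phia ?normr1//.
  by rewrite /coin; case: t; rewrite ?phia ?phib ?normrN normr1.
have sgn2 t : sgn t ^+ 2 = 1.
  by rewrite /sgn /= /coin; case: t; rewrite ?phia ?phib ?sqrrN expr1n.
have half01 : (0 <= 2^-1 :> R) && (2^-1 <= 1 :> R).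
  by rewrite invr_ge0 ler0n invf_le1// ler1n.
have ueps : uniform_pm1 P eps.
  have N1 : (-1 : R) <> 1.
    by apply/eqP; rewrite lt_eqF// gtrN.
  have epsT : sgn true = 1 by rewrite /sgn /= phia.
  have epsF : sgn false = -1 by rewrite /sgn /= phib.
  rewrite /uniform_pm1 epsE.
  split; rewrite [LHS](bernoulli_probE half01) !diracE.
    by rewrite mem_set ?memNset ?mule0 ?adde0 ?mule1//= epsF.
  rewrite memNset ?mem_set ?mule0 ?add0e ?mule1//= ?epsT; last by move/esym.
  by rewrite /unstable.onem {1}(splitr 1) mul1r addrK.
have XYS i t : S (X i t) /\ S (Y i t).
  rewrite XE YE; split=> //.
  by rewrite /Xf; case: ifP => // _; rewrite /coin; case: t.
have XYind : mutually_independent P (fun i t => (X i t, Y i t)).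
  apply: (@mutually_independent_const _ _ _ _ _ _ _ _ i0 (fun=> (a, o))).
  move=> i ii0; apply/funext => t.
  by rewrite XE YE /Xf (negbTE ii0).
have EZ i : (i <= n)%N ->
    ('E_P[hybrid (fun x => f_ex hn (phi \o x)) X Y i] = 0)%E.
  move=> ilen; rewrite ZE//; apply: (expectation_uniform_pm1 ueps) => //.
  by apply: aeW => t; rewrite epsE.
move=> /(_ _ _ _ _ _ _ XYS XYind EZ).
rewrite [X in 'E_P[X]%E](_ : _ = cst (n%:R ^+ 2)); last first.
  by apply/funext => t; rewrite !ZE// mul0r subr0 exprMn sgn2 mulr1.
rewrite expectation_cst (eq_bigr (fun=> 1%:E)) => [|i _]; last first.
  rewrite [X in 'E_P[X]%E](_ : _ = cst 1) ?expectation_cst//.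
  apply/funext => t; rewrite !ZE ?(ltnW (ltn_ord i))//.
  by rewrite -mulrBl -natrB// subSnn mul1r sgn2.
rewrite sumEFin sumr_const card_ord -EFinM lee_fin expr2 ler_pM2r//.
by rewrite ltr0n.
Qed.

Theorem mainTheorem5 (R : realType) (n : nat) (hn : (0 < n)%N) :
  (forall (d : measure_display) (T : measurableType d) (P : probability T R)
     (X : 'I_n -> {RV P >-> R}),
     mutually_independent P X ->
     (forall i, uniform_pm1 P (X i)) ->
     let Y : 'I_n -> T -> R := fun _ _ => 0 in
     let Z : nat -> T -> R := hybrid (f_ex hn) X Y in
     [/\ forall i : nat, (i <= n)%N ->
           {ae P, forall w, Z i w = i%:R * X (Ordinal hn) w},
         forall i : nat, (i <= n)%N -> ('E_P[Z i] = 0)%E,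
         {ae P, forall w, (Z 0%N w - Z n w) ^+ 2 = n%:R ^+ 2} &
         {ae P, forall w, \sum_(i < n) (Z i.+1 w - Z i w) ^+ 2 = n%:R}])
  /\
  (forall S : set R, (S #= `I_3)%card ->
     forall c : R, c < n%:R -> ~ admissible_constant n S c).
Proof.
split.
  move=> d T P X _ uX Y Z.
  have X1 : {ae P, forall w, forall j, `|X j w| = 1}.
    by apply: filter_forall => j; exact: uniform_pm1_norm.
  have ZE : {ae P, forall w, forall i, (i <= n)%N ->
      Z i w = i%:R * X (Ordinal hn) w}.
    by apply: filterS X1 => w X1 i ilen; exact: hybrid_f_exE.
  have sq w : `|X (Ordinal hn) w| = 1 -> X (Ordinal hn) w ^+ 2 = 1.
    by move=> Xw; rewrite -real_normK ?num_real// Xw expr1n.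
  split.
  - by move=> i ilen; apply: filterS ZE => w; exact.
  - move=> i ilen; apply: (expectation_uniform_pm1 (uX (Ordinal hn))); last first.
      by apply: filterS ZE => w; exact.
    rewrite /Z /hybrid /f_ex.
    have mXY (j : 'I_n) :
        measurable_fun setT (fun w => if (j < i)%N then X j w else Y j w).
      by case: (j < i)%N => /=; [exact: measurable_funPT|exact: measurable_cst].
    apply: measurable_funM; first exact: mXY.
    by apply: measurable_sum => j; apply: measurableT_comp => //; exact: mXY.
  - apply: filterS2 X1 ZE => w /(_ (Ordinal hn))/sq X2 ZE.
    by rewrite !ZE// mul0r sub0r sqrrN exprMn X2 mulr1.
  - apply: filterS2 X1 ZE => w /(_ (Ordinal hn))/sq X2 ZE.
    rewrite (eq_bigr (fun=> 1)) ?sumr_const ?card_ord// => i _.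
    by rewrite !ZE ?(ltnW (ltn_ord i))// -mulrBl -natrB// subSnn mul1r X2.
move=> S; rewrite card_eq_sym => /card_set_bijP[g [gS ginj _]] c cn adm.
have gne i j : (i < 3)%N -> (j < 3)%N -> i != j -> g i != g j.
  move=> i3 j3; apply: contraNN => /eqP gij.
  by apply/eqP/ginj => //; exact: mem_set.
suff : n%:R <= c by rewrite leNgt cn.
apply: (@n_le_admissible_constant _ _ hn S (g 0) (g 1) (g 2)) => //;
  by [exact: gne|exact: gS].
Qed.
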